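(* Let $\mathcal{H}_1,\mathcal{H}_2$ be directed acyclic hypergraphs on the same finite vertex set $V$ and let $A\subseteq V$ be a common set of variables set by intervention, $x_a=a_0$ for every $a\in A$. If $(\mathcal{H}_1,A)$ and $(\mathcal{H}_2,A)$ are factorization-equivalent, then $\mathcal{H}_1$ and $\mathcal{H}_2$ admit the same factorization decomposition.
   Context: Directed hypergraph on $V$: hyperedges $h=(T(h),H(h))$ with disjoint, possibly empty $T(h),H(h)\subseteq V$; $u$ parent of $v$ if $u\in T(h),v\in H(h)$ for some $h$; $u,v$ co-head if $\{u,v\}\subseteq H(h)$ for some $h$. DAH: no partially directed cycle (cyclic sequence $v_1,\dots,v_k,v_1$ with each $v_i$ co-head with or parent of $v_{i+1}$, at least one parent step). Chain components: classes of the transitive-reflexive closure of co-head. $pa(\tau)=\bigcup_{v\in\tau}pa(v)\setminus\tau$; $\mathcal{H}_S$: hyperedges with $T(h)\cup H(h)\subseteq S$; $\mathcal{M}(\mathcal{F})$: inclusion-maximal sets among $\{T(h)\cup H(h):h\in\mathcal{F}\}$. Factorization with intervention: a density $f$ on $\times_{v\in V}\mathcal{X}_v$ (w.r.t. product measure $\mu$) factorizes according to $\mathcal{H}$ with $A$ intervened if configurations with $x_a\ne a_0$ for some $a\in A$ have probability zero and $f(x\|x_A)=\prod_\tau f(x_{\tau\setminus A}\mid x_{pa(\tau)},x_{\tau\cap A})$ over chain components $\tau$, where, with $\mathcal{H}^*_\tau$ the hyperedges $h$ of $\mathcal{H}_{\tau\cup pa(\tau)}$ with $H(h)\subseteq\tau$,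 $f(x_{\tau\setminus A}\mid x_{pa(\tau)},x_{\tau\cap A})=Z^{-1}(x_{pa(\tau)},x_{\tau\cap A})\prod_{h\in\mathcal{M}(\mathcal{H}^*_\tau)}\psi_h(x)$, $\psi_h\ge0$ depending only on $x_h$, $Z=\int_{\mathcal{X}_{\tau\setminus A}}\prod_h\psi_h\,d\mu_{\tau\setminus A}$. Two DAHs admit the same factorization decomposition if every density factorizing according to one (with $A$ intervened) factorizes according to the other, and vice versa. Factorization-equivalence: $(\mathcal{H}_1,A)$ and $(\mathcal{H}_2,A)$ are factorization-equivalent if performing the following operations on each $\mathcal{H}_i$ yields the same DAH: (i) delete all hyperedges with empty head; (ii) delete every hyperedge $h$ for which there is another hyperedge $h'$ with $T(h)\subseteq T(h')$ and $H(h)\subseteq H(h')$; (iii) replace every hyperedge $h$ by $(T(h)\setminus A,H(h)\setminus A)$.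
   Formalization: In the factorization, H*_τ contains only hyperedges with nonempty head H(h) ⊆ τ; with empty heads admitted, as literally written, the claim fails, since operation (i) deletes hyperedges that would change M(H*_τ). *)

(* Defs.v *)
From HB Require Import structures.
From mathcomp Require Import all_boot all_order all_algebra.
From mathcomp Require Import all_classical all_reals all_analysis.

Set Implicit Arguments.
Unset Strict Implicit.
Unset Printing Implicit Defensive.
Import Order.TTheory GRing.Theory Num.Theory.

Local Open Scope ring_scope.

(* [{set T}] is a finite set; the sets of MathComp-Analysis are written
   [set T], without braces. *)

Section Hypergraphs.
Variable V : finType.

(* A hyperedge is the pair (tail, head). *)
Definition hyperedge : Type := ({set V} * {set V})%type.

Definition tail_of (h : hyperedge) : {set V} := h.1.
Definition head_of (h : hyperedge) : {set V} := h.2.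
Definition vertices_of (h : hyperedge) : {set V} := tail_of h :|: head_of h.

Definition hypergraph : Type := {set ({set V} * {set V})}.

Implicit Types (H : hypergraph) (u v : V) (tau S : {set V}).

Definition parent H : rel V :=
  fun u v => [exists h in H, (u \in tail_of h) && (v \in head_of h)].

Definition cohead H : rel V :=
  fun u v => [exists h in H, [set u; v] \subset head_of h].

(* [zip c (rot 1 c)] lists the steps v_1 v_2, ..., v_(k-1) v_k, v_k v_1 of
   the cyclic sequence c = v_1, ..., v_k. *)
Definition partially_directed_cycle H (c : seq V) : bool :=
  all (fun s => cohead H s.1 s.2 || parent H s.1 s.2) (zip c (rot 1 c)) &&
  has (fun s => parent H s.1 s.2) (zip c (rot 1 c)).

Definition is_DAH H : Prop :=
  (forall h, h \in H -> [disjoint tail_of h & head_of h]) /\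
  (forall c : seq V, ~~ partially_directed_cycle H c).

(* [cohead H] is symmetric, hence [connect (cohead H)], its
   reflexive-transitive closure, is an equivalence relation. *)
Definition chain_components H : {set {set V}} :=
  equivalence_partition (connect (cohead H)) [set: V].

Definition pa_vertex H v : {set V} := [set u | parent H u v].
Definition pa H tau : {set V} := (\bigcup_(v in tau) pa_vertex H v) :\: tau.

Definition sub_hypergraph H S : hypergraph :=
  [set h in H | vertices_of h \subset S].

(* The hyperedges pointing into tau.  A hyperedge with empty head points
   nowhere and contributes no factor to the density of x_tau given x_pa(tau):
   were it admitted on the ground that the empty set is a subset of tau, a
   hyperedge with empty head and tail tau would make this density arbitrary,
   and deleting empty heads would change the factorization. *)
Definition hyperedges_into H tau : hypergraph :=
  [set h in sub_hypergraph H (tau :|: pa H tau) |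
    (head_of h != finset.set0) && (head_of h \subset tau)].

Definition maximal_supports H : {set {set V}} :=
  [set S | maxset (fun S' => S' \in [set vertices_of h | h in H]) S].

Definition delete_empty_heads H : hypergraph :=
  [set h in H | head_of h != finset.set0].

Definition delete_dominated H : hypergraph :=
  [set h in H | ~~ [exists h' in H,
     [&& h' != h, tail_of h \subset tail_of h' & head_of h \subset head_of h']]].

Definition remove_intervened (A : {set V}) H : hypergraph :=
  [set (tail_of h :\: A, head_of h :\: A) | h in H].

Definition reduction (A : {set V}) H : hypergraph :=
  remove_intervened A (delete_dominated (delete_empty_heads H)).

Definition factorization_equivalent (A : {set V}) (H1 H2 : hypergraph) : Prop :=
  reduction A H1 = reduction A H2.

End Hypergraphs.

Section Factorization.
Variables (R : realType) (V : finType) (d : V -> measure_display).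
Variable X : forall v : V, measurableType (d v).
Variable mu : forall v : V, {sigma_finite_measure set (X v) -> \bar R}.

Definition configuration : Type := forall v : V, X v.

HB.instance Definition _ := Pointed.on configuration.

(* The generators of the product sigma-algebra. *)
Definition cylinders : set (set configuration) :=
  (\bigcup_(v in [set: V])
     preimage_set_system setT (fun x : configuration => x v) measurable)%classic.

Definition measurable_configuration_fun (g : configuration -> R) : Prop :=
  measurable_fun [set: g_sigma_algebraType cylinders]%classic g.

Definition depends_only_on (S : {set V}) (g : configuration -> R) : Prop :=
  forall x y : configuration, (forall v, v \in S -> x v = y v) -> g x = g y.

(* The integral of g against the product measure of the mu v, for v in S, with
   the coordinates outside S held at those of x.  As for the binary product
   measure m1 \x m2 of the library, it is obtained by integrating one
   coordinate after the other; all the integrands below are measurable and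
   nonnegative, so the order is irrelevant (Tonelli).  [dfwith x v y] is x
   with its coordinate v replaced by y. *)
Fixpoint iterated_integral (s : seq V) (g : configuration -> \bar R)
    (x : configuration) : \bar R :=
  if s is v :: s' then
    (\int[mu v]_y iterated_integral s' g (dfwith x v y))%E
  else g x.

Definition product_integral (S : {set V}) (g : configuration -> R)
    (x : configuration) : \bar R :=
  iterated_integral (enum S) (fun y => (g y)%:E) x.

Variables (A : {set V}) (a0 : configuration).

Definition intervened_at (x : configuration) : Prop :=
  forall a, a \in A -> x a = a0 a.

(* A density when the coordinates in A are set to a0: the mass sits on
   x_A = a0, where f is a density in the remaining coordinates. *)
Definition is_intervention_density (f : configuration -> R) : Prop :=
  [/\ forall x, 0 <= f x,
      measurable_configuration_fun f,
      forall x, ~ intervened_at x -> f x = 0 &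
      product_integral (~: A) f a0 = 1%E].

Definition is_potential (S : {set V}) (psi : configuration -> R) : Prop :=
  [/\ forall x, 0 <= psi x,
      measurable_configuration_fun psi &
      depends_only_on S psi].

Section ChainComponent.
Variables (H : hypergraph V) (tau : {set V}).
Variable psi : {set V} -> configuration -> R.

Definition component_product (x : configuration) : R :=
  \prod_(S in maximal_supports (hyperedges_into H tau)) psi S x.

Definition normalizer (x : configuration) : \bar R :=
  product_integral (tau :\: A) component_product x.

(* f(x_(tau \ A) | x_pa(tau), x_(tau /\ A)).  Where the normalizer is 0 or
   +oo there is no conditional density; the value 0 is then the usual
   convention 0 / 0 = 0, and makes the configurations x_pa(tau) concerned
   null for any density which is a product of such factors. *)
Definition conditional_factor (x : configuration) : R :=
  if (0 < normalizer x < +oo)%E then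
    (fine (normalizer x))^-1 * component_product x
  else 0.

End ChainComponent.

Definition factorizes (H : hypergraph V) (f : configuration -> R) : Prop :=
  exists psi : {set V} -> {set V} -> configuration -> R,
    (forall tau S, tau \in chain_components H ->
       S \in maximal_supports (hyperedges_into H tau) ->
       is_potential S (psi tau S)) /\
    (forall x, intervened_at x ->
       f x = \prod_(tau in chain_components H)
               conditional_factor H tau (psi tau) x).

Definition same_factorization_decomposition (H1 H2 : hypergraph V) : Prop :=
  forall f, is_intervention_density f -> (factorizes H1 f <-> factorizes H2 f).

End Factorization.

(* Main.v *)
(* Restricted to x_A = a0, both factorizations have a common refinement which
   depends on the reduced hypergraph only.  By acyclicity the maximal supports
   in a chain component tau are in bijection with the non-dominated hyperedges
   whose head lies in tau.  Removing A splits tau \ A into connected blocks of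
   the reduced hypergraph; the potentials attached to different blocks do not
   share coordinates in tau \ A, so the normalizer of tau is the product of the
   normalizers of the blocks.  A hyperedge with head inside A belongs to no
   block: its potential is constant for the integration and only contributes
   the indicator that it is positive.  Multiplying together the potentials of
   the hyperedges of H1 with the same reduction, and giving the product to one
   hyperedge of H2 with this reduction, transports a factorization. *)
Require Import Defs.
From HB Require Import structures.
From mathcomp Require Import all_boot all_order all_algebra.
From mathcomp Require Import all_classical all_reals all_analysis.
From mathcomp Require Import measurable_realfun.

Set Implicit Arguments.
Unset Strict Implicit.
Unset Printing Implicit Defensive.
Import Order.TTheory GRing.Theory Num.Theory.

Local Open Scope ring_scope.

(** * Finite parts of nonnegative extended reals *)

Section ExtendedReals.
Variable R : realType.
Local Open Scope ereal_scope.

(** Infinite values are covered because [fine] sends [+oo] to [0]: a product with a factor [+oo] is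
    [0] or [+oo], and both sides vanish. This lets degenerate normalizers multiply like finite
    ones. *)
Lemma fineM_ge0 (x y : \bar R) :
  0 <= x -> 0 <= y -> fine (x * y) = (fine x * fine y)%R.
Proof.
case: x => [r| |] //; case: y => [s| |] //; rewrite ?lee_fin => x0 y0 /=.
- by move: x0; rewrite le_eqVlt mulr0 => /predU1P[<-|r0];
    rewrite ?mul0e // gt0_muley.
- by move: y0; rewrite le_eqVlt mul0r => /predU1P[<-|r0];
    rewrite ?mule0 // gt0_mulye.
- by rewrite mulr0.
Qed.

Lemma fine_prod_ge0 (I : finType) (P : pred I) (F : I -> \bar R) :
  (forall i, P i -> 0 <= F i) ->
  fine (\big[*%E/1]_(i | P i) F i) = (\prod_(i | P i) fine (F i))%R.
Proof.
move=> F0.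
suff [] : 0 <= \big[*%E/1]_(i | P i) F i /\
   fine (\big[*%E/1]_(i | P i) F i) = (\prod_(i | P i) fine (F i))%R by [].
elim/big_rec2: _ => // i z y Pi [y0 <-].
by rewrite mule_ge0 ?F0 // fineM_ge0 ?F0.
Qed.

End ExtendedReals.

(** * Iterated integrals on configurations and normalization of products *)

Section Integration.
Variables (R : realType) (V : finType) (d : V -> measure_display).
Variable X : forall v : V, measurableType (d v).
Variable mu : forall v : V, {sigma_finite_measure set (X v) -> \bar R}.

Local Notation conf := (g_sigma_algebraType (@cylinders V d X)).
Implicit Types (s : seq V) (x : configuration X).

Lemma measurable_coordinate v :
  measurable_fun [set: conf]%classic (fun x : conf => x v).
Proof.
by move=> _ Y mY; apply: sub_sigma_algebra; exists v => //; exists Y.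
Qed.

Lemma measurable_to_configuration d' (T : measurableType d') (f : T -> conf) :
  (forall v, measurable_fun [set: T]%classic
     (fun t => (f t : configuration X) v)) ->
  measurable_fun [set: T]%classic f.
Proof.
move=> mf; apply: (@measurability _ _ T conf _ f (@cylinders V d X) erefl).
move=> _ [_ [v _ [Y mY <-]] <-]; rewrite [X in (_ `&` f @^-1` X)%classic]setTI.
exact: (mf v measurableT Y mY).
Qed.

(** Joint measurability in the configuration and the new coordinate is what Tonelli's theorem needs
    for each single integration. *)
Lemma measurable_dfwith v :
  measurable_fun [set: conf * X v]%classic
    (fun p : conf * X v => dfwith (p.1 : configuration X) v p.2 : conf).
Proof.
apply: measurable_to_configuration => w.
have [<-|vw] := eqVneq v w.
  apply: (eq_measurable_fun snd) => [p _|]; first by rewrite dfwithin.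
  exact: measurable_snd.
apply: (eq_measurable_fun (fun p : conf * X v => p.1 w)) => [p _|].
  by rewrite dfwithout.
apply: (measurableT_comp (f := fun x : conf => x w)).
  exact: measurable_coordinate.
exact: measurable_fst.
Qed.

Lemma iterated_integral_ge0 s (g : configuration X -> \bar R) x :
  (forall y, 0 <= g y)%E -> (0 <= iterated_integral mu s g x)%E.
Proof.
by move=> g0; elim: s x => //= v s IH x; apply: integral_ge0 => y _; apply: IH.
Qed.

Lemma measurable_iterated_integral s (g : configuration X -> \bar R) :
  (forall y, 0 <= g y)%E ->
  measurable_fun [set: conf]%classic (g : conf -> \bar R) ->
  measurable_fun [set: conf]%classic
    (iterated_integral mu s g : conf -> \bar R).
Proof.
move=> g0 mg; elim: s => //= v s IH.
apply: (measurable_fun_fubini_tonelli_F (m2 := mu v)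
  (fun p : conf * X v =>
     iterated_integral mu s g (dfwith (p.1 : configuration X) v p.2))).
  exact: (measurableT_comp IH (@measurable_dfwith v)).
by move=> p; apply: iterated_integral_ge0.
Qed.

(** The integral at [x] only visits configurations that agree with [x] off [s]. In particular,
    integrating outside [A] never leaves the intervened configurations. *)
Lemma eq_iterated_integral s (g h : configuration X -> \bar R) x :
  (forall y, (forall v, v \notin s -> y v = x v) -> g y = h y) ->
  iterated_integral mu s g x = iterated_integral mu s h x.
Proof.
elim: s x => [|v s IH] x gh /=; first exact: gh.
apply: eq_integral => z _; apply: IH => y yx; apply: gh => w.
rewrite inE negb_or => /andP[wv ws]; rewrite yx // dfwithout // eq_sym.
by rewrite wv.
Qed.

Lemma iterated_integral_dfwith s (g : configuration X -> \bar R) x v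
    (z : X v) :
  v \notin s -> (forall y (z : X v), g (dfwith y v z) = g y) ->
  iterated_integral mu s g (dfwith x v z) = iterated_integral mu s g x.
Proof.
move=> + gv; elim: s x => [|w s IH] x //=.
rewrite inE negb_or => /andP[vw vs].
(* Updates at the distinct coordinates [v] and [w] commute. *)
apply: eq_integral => t _; rewrite -[RHS]IH //; congr iterated_integral.
apply: functional_extensionality_dep => u.
have [<-|wu] := eqVneq w u; first by rewrite dfwithin dfwithout ?dfwithin.
rewrite dfwithout //; have [<-|vu] := eqVneq v u; first by rewrite !dfwithin.
by rewrite !dfwithout.
Qed.

(* Since a filter keeps the order of [s], no exchange of integrals is needed. *)
Lemma iterated_integral_prod (I : finType) (P : pred I) (B : I -> {set V})
    (g : I -> configuration X -> \bar R) s x :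
  (forall i, P i -> forall y, 0 <= g i y)%E ->
  (forall i, P i ->
     measurable_fun [set: conf]%classic (g i : conf -> \bar R)) ->
  uniq s ->
  (forall v, v \in s -> exists2 i, P i & v \in B i /\
     forall j, P j -> j != i -> v \notin B j /\
       forall y (z : X v), g j (dfwith y v z) = g j y) ->
  iterated_integral mu s (fun y => \big[*%E/1%E]_(i | P i) g i y) x =
  \big[*%E/1%E]_(i | P i) iterated_integral mu [seq v <- s | v \in B i] (g i) x.
Proof.
move=> g0 mg; elim: s x => [|v s IH] x //= /andP[vs us] sB.
have [i Pi [vi vj]] := sB v (mem_head _ _).
have {}IH y := IH y us (fun w ws => sB w (mem_behead (s := v :: s) ws)).
rewrite [RHS](bigD1 i) //= vi /=.
(* Only the factor [i] sees the coordinate [v]. The other factors form a constant [c], possibly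
   [+oo], which leaves the integral by nonnegativity. *)
set c := \big[*%E/1%E]_(j | P j && (j != i)) _.
have c0 : (0 <= c)%E.
  apply: prode_ge0 => j /andP[Pj _]; apply: iterated_integral_ge0.
  exact: g0.
rewrite muleC -ge0_integralZl //; first last.
- by move=> y _; apply: iterated_integral_ge0; apply: g0.
- apply: (measurableT_comp (f := iterated_integral mu _ (g i) : conf -> _)).
    by apply: measurable_iterated_integral; [apply: g0|apply: mg].
  apply: (measurableT_comp (measurable_dfwith (v := v))
           (g := fun y => (x : conf, y))).
  exact: measurable_pair1.
apply: eq_integral => y _; rewrite IH (bigD1 i) //= muleC; congr (_ * _)%E.
apply: eq_bigr => j /andP[Pj ji]; have [vBj gj] := vj j Pj ji.
rewrite (negbTE vBj) iterated_integral_dfwith //.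
by rewrite mem_filter (negbTE vs) andbF.
Qed.

(* [g] divided by its integral over the coordinates in [B]; [fine] sends [+oo]
   to [0], so the value is [0] when the integral is [0] or [+oo]. *)
Definition normalized (B : {set V}) (g : configuration X -> R) x : R :=
  (fine (product_integral mu B g x))^-1 * g x.

Lemma eq_normalized (B : {set V}) (g h : configuration X -> R) x :
  (forall y, (forall v, v \notin B -> y v = x v) -> g y = h y) ->
  normalized B g x = normalized B h x.
Proof.
move=> gh; rewrite /normalized gh //; congr ((fine _)^-1 * _).
apply: eq_iterated_integral => y yx; rewrite gh // => v vB.
by apply: yx; rewrite mem_enum.
Qed.

(** Each coordinate of [C] is owned by exactly one factor and ignored by the others, so the
    normalizer splits. Thanks to [0^-1 = 0] the identity also holds when some normalizer is [0] or
    [+oo]. *)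
Lemma normalized_prod (I : finType) (P : pred I) (B : I -> {set V})
    (C : {set V}) (g : I -> configuration X -> R) x :
  (forall i, P i -> forall y, 0 <= g i y) ->
  (forall i, P i -> measurable_configuration_fun (g i)) ->
  (forall i, P i -> B i \subset C) ->
  (forall v, v \in C -> exists2 i, P i & v \in B i /\
     forall j, P j -> j != i -> v \notin B j /\
       forall y (z : X v), g j (dfwith y v z) = g j y) ->
  normalized C (fun y => \prod_(i | P i) g i y) x =
  \prod_(i | P i) normalized (B i) (g i) x.
Proof.
move=> g0 mg BC CB; rewrite /normalized big_split /= prodfV; congr (_ * _).
rewrite /product_integral -fine_prod_ge0 => [|i Pi]; last first.
  by apply: iterated_integral_ge0 => y; rewrite lee_fin g0.
congr (fine _)^-1.
have -> : (fun y => (\prod_(i | P i) g i y)%:E) =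
          (fun y => \big[*%E/1%E]_(i | P i) (g i y)%:E).
  by apply: funext => y; rewrite prodEFin.
rewrite (iterated_integral_prod (B := B)).
- apply: eq_bigr => i Pi; congr iterated_integral.
  rewrite /enum_mem -filter_predI; apply: eq_filter => v /=.
  by rewrite andb_idr => // vB; rewrite (fintype.subsetP (BC i Pi)).
- by move=> i Pi y; rewrite lee_fin g0.
- by move=> i Pi; apply/measurable_EFinP; apply: mg.
- exact: enum_uniq.
- move=> v; rewrite mem_enum => /CB[i Pi [vi vj]]; exists i => //; split=> //.
  by move=> j Pj ji; have [vBj gj] := vj j Pj ji; split=> // y z; rewrite gj.
Qed.

(** The test on the normalizer is absorbed by the conventions: at [0] and at [+oo], [fine] gives
    [0], whose inverse is [0]. *)
Lemma conditional_factorE (A : {set V}) (H : hypergraph V) (tau : {set V})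
    (psi : {set V} -> configuration X -> R) :
  (forall S, S \in maximal_supports (hyperedges_into H tau) ->
     forall y, 0 <= psi S y) ->
  conditional_factor mu A H tau psi =
  normalized (tau :\: A) (component_product H tau psi).
Proof.
move=> psi0; apply: funext => x; rewrite /conditional_factor /normalized.
rewrite -/(normalizer mu A H tau psi x).
have : (0 <= normalizer mu A H tau psi x)%E.
  by apply: iterated_integral_ge0 => y; rewrite lee_fin prodr_ge0 // => S /psi0.
case: normalizer => [r| |] //=; rewrite ?ltxx ?andbF ?invr0 ?mul0r //.
rewrite lee_fin lte_fin ltry andbT le_eqVlt => /predU1P[<-|-> //].
by rewrite ltxx invr0 mul0r.
Qed.

End Integration.

(** * Chain components and the maximal supports of a DAH *)

Section Components.
Variable V : finType.
Implicit Types (H : hypergraph V) (tau S : {set V}) (h : hyperedge V).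

Definition component H v : {set V} := [set u | connect (cohead H) v u].

Lemma cohead_connect_sym H : connect_sym (cohead H).
Proof. by apply: sym_connect_sym => u v; rewrite /cohead finset.setUC. Qed.

Lemma component_refl H v : v \in component H v.
Proof. by rewrite inE connect0. Qed.

Lemma chain_componentP H tau :
  reflect (exists v, tau = component H v) (tau \in chain_components H).
Proof.
have E v : [set u in [set: V] | connect (cohead H) v u] = component H v.
  by apply/setP => u; rewrite !inE.
apply: (iffP imsetP) => [[v _ ->]|[v ->]]; first by exists v.
by exists v; rewrite ?inE.
Qed.

Lemma component_chain H v : component H v \in chain_components H.
Proof. by apply/chain_componentP; exists v. Qed.

Lemma mem_chain_component H tau v :
  tau \in chain_components H -> v \in tau -> tau = component H v.
Proof.
move=> /chain_componentP[w ->]; rewrite inE => wv; apply/setP => u.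
by rewrite !inE (same_connect (@cohead_connect_sym H) wv).
Qed.

Lemma chain_component_neq0 H tau :
  tau \in chain_components H -> exists v, v \in tau.
Proof. by move=> /chain_componentP[v ->]; exists v; apply: component_refl. Qed.

Lemma head_cohead H h u v :
  h \in H -> u \in head_of h -> v \in head_of h -> cohead H u v.
Proof.
move=> hH uh vh; apply/exists_inP; exists h => //.
by rewrite finset.subUset !finset.sub1set uh.
Qed.

Lemma head_sub_component H h v :
  h \in H -> v \in head_of h -> head_of h \subset component H v.
Proof.
move=> hH vh; apply/fintype.subsetP => u uh; rewrite inE.
exact/connect1/(head_cohead hH).
Qed.

Lemma head_sub_chain_component H tau h v :
  tau \in chain_components H -> h \in H -> v \in head_of h -> v \in tau ->
  head_of h \subset tau.
Proof.
by move=> tauH hH vh /(mem_chain_component tauH) ->; apply: head_sub_component.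
Qed.

(** The end point [y] is kept free for the induction; taking [y] to be [x] gives the steps of the
    cyclic sequence [x :: p]. *)
Lemma all_steps (T : Type) (r : rel T) (x y : T) (p : seq T) :
  all (fun s => r s.1 s.2) (zip (x :: p) (rcons p y)) = path r x (rcons p y).
Proof. by elim: p x => //= z p IH x; rewrite IH. Qed.

Lemma has_last_step (T : Type) (r : rel T) (x y : T) (p : seq T) :
  r (last x p) y -> has (fun s => r s.1 s.2) (zip (x :: p) (rcons p y)).
Proof. by elim: p x => [|z p IH] x /= ry; rewrite ?ry // IH // orbT. Qed.

(** Otherwise a co-head path inside [tau] from a head vertex [u] to the tail vertex [v], closed by
    the parent step from [v] to [u], would be a partially directed cycle. *)
Lemma tail_notin_component H tau h v :
  is_DAH H -> tau \in chain_components H -> h \in H -> head_of h \subset tau ->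
  head_of h != finset.set0 -> v \in tail_of h -> v \notin tau.
Proof.
move=> [_ acyclic] tauH hH htau /set0Pn[u uh] vh; apply/negP => vtau.
have := fintype.subsetP htau u uh; rewrite (mem_chain_component tauH vtau).
rewrite inE cohead_connect_sym => /connectP[p pp vp].
have pvu : parent H v u by apply/exists_inP; exists h; rewrite // vh.
apply: (negP (acyclic (u :: p))); rewrite /partially_directed_cycle rot1_cons.
rewrite has_last_step -?vp // andbT.
rewrite (all_steps (fun a b => cohead H a b || parent H a b)) rcons_path -vp.
rewrite pvu orbT andbT; apply: sub_path pp => a b /= -> //.
Qed.

Definition nondominated H : hypergraph V :=
  delete_dominated (delete_empty_heads H).

Lemma nondominatedP H h :
  reflect [/\ h \in H, head_of h != finset.set0 &
    forall h', h' \in H -> tail_of h \subset tail_of h' ->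
      head_of h \subset head_of h' -> h' = h] (h \in nondominated H).
Proof.
rewrite !inE -andbA; apply: (iffP and3P) => [[hH h0 /exists_inPn nd]|].
  split=> // h' h'H th hh; apply/eqP/negPn/negP => h'h.
  (* A dominating hyperedge inherits a nonempty head, so it survives the deletion of empty heads. *)
  have h'0 : head_of h' != finset.set0.
    have /set0Pn[v vh] := h0; apply/set0Pn; exists v.
    exact: (fintype.subsetP hh).
  by have := nd h'; rewrite inE h'H h'0 h'h th hh => /(_ isT).
move=> [hH h0 nd]; split=> //; apply/exists_inPn => h'; rewrite inE.
case/andP=> h'H _; apply/negP => /and3P[/eqP h'h th hh].
by apply: h'h; apply: nd.
Qed.

Section Supports.
Variables (H : hypergraph V) (tau : {set V}).
Hypotheses (dahH : is_DAH H) (tauH : tau \in chain_components H).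

(** The tail of a hyperedge pointing into [tau] consists of parents of a head vertex and avoids
    [tau] by acyclicity, so it lies in [pa H tau] automatically. *)
Lemma hyperedges_intoE :
  hyperedges_into H tau =
  [set h in H | (head_of h != finset.set0) && (head_of h \subset tau)].
Proof.
apply/setP => h; rewrite !inE -andbA; apply: andb_id2l => hH.
rewrite andb_idl // => /andP[h0 htau].
rewrite finset.subUset (fintype.subset_trans htau (finset.subsetUl _ _)) andbT.
apply/fintype.subsetP => v vh; rewrite !inE.
rewrite (negbTE (tail_notin_component dahH tauH hH htau h0 vh)) /=.
apply/finset.bigcupP.
have /set0Pn[u uh] := h0; exists u; first exact: (fintype.subsetP htau).
by rewrite inE; apply/exists_inP; exists h; rewrite // vh.
Qed.

(** Acyclicity makes [tau] separate head from tail, so a hyperedge can be recovered from its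
    support. *)
Lemma vertices_split h :
  h \in H -> head_of h != finset.set0 -> head_of h \subset tau ->
  (vertices_of h :\: tau = tail_of h) * (vertices_of h :&: tau = head_of h).
Proof.
move=> hH h0 htau; split; apply/setP => v; rewrite !inE;
  have /implyP := fintype.subsetP htau v;
  have /implyP := tail_notin_component (v := v) dahH tauH hH htau h0;
  by case: (v \in tail_of h); case: (v \in head_of h); case: (v \in tau).
Qed.

Lemma vertices_subset h h' :
  h \in H -> head_of h != finset.set0 -> head_of h \subset tau ->
  h' \in H -> head_of h' != finset.set0 -> head_of h' \subset tau ->
  vertices_of h \subset vertices_of h' ->
  tail_of h \subset tail_of h' /\ head_of h \subset head_of h'.
Proof.
move=> hH h0 htau h'H h'0 h'tau hh'.
rewrite -(vertices_split hH h0 htau).1 -(vertices_split hH h0 htau).2.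
rewrite -(vertices_split h'H h'0 h'tau).1 -(vertices_split h'H h'0 h'tau).2.
by rewrite finset.setSD // finset.setSI.
Qed.

(** Among hyperedges pointing into [tau], inclusion of supports is inclusion of both tails and
    heads, so maximality coincides with not being dominated. *)
Lemma maximal_supportsE :
  maximal_supports (hyperedges_into H tau) =
  [set vertices_of h | h in [set h in nondominated H | head_of h \subset tau]].
Proof.
rewrite hyperedges_intoE; apply/setP => S; rewrite inE.
apply/maxsetP/imsetP => [[]|[h]].
  move=> /imsetP[h]; rewrite inE => /and3P[hH h0 htau] -> max_h.
  exists h => //; rewrite inE htau andbT; apply/nondominatedP; split=> //.
  move=> h' h'H th hh.
  (* A dominating [h'] shares a head vertex with [h], so it also points into [tau] and its support
     competes with that of [h]. *)
  have [v vh] := set0Pn _ h0; have vh' := fintype.subsetP hh v vh.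
  have vtau := fintype.subsetP htau v vh.
  have h'tau := head_sub_chain_component tauH h'H vh' vtau.
  have h'0 : head_of h' != finset.set0 by apply/set0Pn; exists v.
  have vE : vertices_of h' = vertices_of h.
    apply: max_h; last exact: finset.setUSS.
    by apply: imset_f; rewrite inE h'H h'0.
  have := vertices_split h'H h'0 h'tau; rewrite vE.
  rewrite (vertices_split hH h0 htau).1 (vertices_split hH h0 htau).2.
  by case: h {hH h0 htau max_h th hh vh vE} => a b; case: h' {h'H vh' h'tau h'0}
    => a' b' [/= -> ->].
rewrite inE => /andP[/nondominatedP[hH h0 nd] htau] ->; split.
  by apply: imset_f; rewrite inE hH h0.
move=> S' /imsetP[h'].
rewrite inE => /and3P[h'H h'0 h'tau] -> hh'.
have [th hh] := vertices_subset hH h0 htau h'H h'0 h'tau hh'.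
by rewrite (nd h').
Qed.

Lemma vertices_inj :
  {in [set h in nondominated H | head_of h \subset tau] &,
    injective (@vertices_of V)}.
Proof.
move=> h h' /finset.setIdP[/nondominatedP[hH h0 nd] htau].
move=> /finset.setIdP[/nondominatedP[h'H h'0 _] h'tau] hh'.
have [] := vertices_subset hH h0 htau h'H h'0 h'tau; first by rewrite hh'.
by move=> th hh; rewrite (nd h').
Qed.

End Supports.
End Components.

(** * Closure properties of potentials *)

Section Potentials.
Variables (R : realType) (V : finType) (d : V -> measure_display).
Variable X : forall v : V, measurableType (d v).
Implicit Types (S : {set V}) (g : configuration X -> R).

Lemma depends_only_on_dfwith S g v :
  depends_only_on S g -> v \notin S ->
  forall (y : configuration X) (z : X v), g (dfwith y v z) = g y.
Proof.
move=> gS vS y z; apply: gS => w wS; rewrite dfwithout //.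
by apply: contraNneq vS => ->.
Qed.

Lemma potential_widen S S' g :
  S \subset S' -> is_potential S g -> is_potential S' g.
Proof.
move=> SS' [g0 mg gS]; split=> // x y xy; apply: gS => v vS.
by apply: xy; apply: (fintype.subsetP SS').
Qed.

Lemma potential_one S : is_potential S (fun _ : configuration X => 1 : R).
Proof. by split=> [x||x y] //; apply: measurable_cst. Qed.

Lemma potential_prod (I : finType) (P : pred I) S
    (g : I -> configuration X -> R) :
  (forall i, P i -> is_potential S (g i)) ->
  is_potential S (fun x => \prod_(i | P i) g i x).
Proof.
move=> gP; split=> [x||x y xy].
- by apply: prodr_ge0 => i /gP[].
- have -> : (fun x => \prod_(i | P i) g i x) =
            (fun x => \prod_(i <- [seq i <- index_enum I | P i]) g i x).
    by apply: funext => x; rewrite big_filter.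
  by apply: measurable_prod => i; rewrite mem_filter => /andP[/gP[]].
- by apply: eq_bigr => i /gP[_ _ gS]; apply: gS.
Qed.

Definition intervene (A : {set V}) (a0 x : configuration X) : configuration X :=
  fun v => if v \in A then a0 v else x v.

Lemma intervene_id A a0 x : intervened_at A a0 x -> intervene A a0 x = x.
Proof.
move=> xA; apply: functional_extensionality_dep => v; rewrite /intervene.
by case: ifP => // /xA.
Qed.

(** Freezing the coordinates in [A] frees the potential from them. Hyperedges with the same
    reduction may differ on [A], so this is what lets one carry the potential of another. *)
Lemma potential_intervene A (a0 : configuration X) S g :
  is_potential S g -> is_potential (S :\: A) (g \o intervene A a0).
Proof.
move=> [g0 mg gS]; split=> [x||x y xy] /=; first exact: g0.
  apply: (measurableT_comp mg); apply: measurable_to_configuration => v.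
  rewrite /intervene; case: (v \in A); first exact: measurable_cst.
  exact: measurable_coordinate.
apply: gS => v vS; rewrite /intervene; case: ifP => // vA.
by apply: xy; rewrite inE vA.
Qed.

End Potentials.

(** * Blocks of the reduced hypergraph *)

Section Blocks.
Variables (V : finType) (A : {set V}).
Implicit Types (H E : hypergraph V) (h e : hyperedge V).

(** For a nonempty [S] inside one component this is that component. The union avoids choosing a
    vertex and gives the empty block when [S] is empty. *)
Definition block E (S : {set V}) : {set V} := \bigcup_(v in S) component E v.

Lemma block_head E e v :
  e \in E -> v \in head_of e -> block E (head_of e) = component E v.
Proof.
move=> eE ve; apply/eqP; rewrite finset.eqEsubset; apply/andP; split.
  apply/finset.bigcupsP => u ue.
  have uv := fintype.subsetP (head_sub_component eE ve) u ue.
  by rewrite -(mem_chain_component (component_chain E v) uv).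
exact: finset.bigcup_sup.
Qed.

Lemma block_sub E e : head_of e \subset block E (head_of e).
Proof.
apply/fintype.subsetP => v ve; apply/finset.bigcupP; exists v => //.
exact: component_refl.
Qed.

Definition reduce h : hyperedge V := (tail_of h :\: A, head_of h :\: A).

Lemma mem_reduce H h : h \in nondominated H -> reduce h \in reduction A H.
Proof. exact: imset_f. Qed.

(** Deleting hyperedges and shrinking heads can only remove co-head pairs. *)
Lemma component_reduction H v :
  component (reduction A H) v \subset component H v.
Proof.
apply/fintype.subsetP => u; rewrite !inE.
apply: connect_sub => {}v {}u /exists_inP[_ /imsetP[h hD ->]] /= vu.
apply: connect1; have [hH _ _] := nondominatedP _ _ hD.
apply/exists_inP; exists h => //; apply: fintype.subset_trans vu _.
exact: finset.subsetDl.
Qed.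

Lemma block_reduction H sigma v :
  sigma \in chain_components (reduction A H) -> v \in sigma ->
  block H sigma = component H v.
Proof.
move=> sE vs; apply/eqP; rewrite finset.eqEsubset finset.bigcup_sup // andbT.
apply/finset.bigcupsP => u us; have uv : u \in component H v.
  apply: (fintype.subsetP (component_reduction H v)).
  by rewrite -(mem_chain_component sE vs).
by rewrite -(mem_chain_component (component_chain H v) uv).
Qed.

(** This is the label by which potentials are grouped; hyperedges with head inside [A] get the empty
    label. *)
Definition reduced_block H h : {set V} :=
  block (reduction A H) (head_of (reduce h)).

Variant reduced_block_spec H h : {set V} -> Prop :=
| ReducedEmpty of head_of h \subset A : reduced_block_spec H h finset.set0
| ReducedComponent v of v \in head_of h & v \notin A :
    reduced_block_spec H h (component (reduction A H) v).

Lemma reduced_blockP H h :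
  h \in nondominated H -> reduced_block_spec H h (reduced_block H h).
Proof.
move=> hD; have [hA|/set0Pn[v vh]] := eqVneq (head_of (reduce h)) finset.set0.
  rewrite /reduced_block hA /block big_set0; apply: ReducedEmpty.
  by rewrite -finset.setD_eq0; apply/eqP.
rewrite /reduced_block (block_head (mem_reduce hD) vh).
by move: vh; rewrite inE => /andP[vA vh]; apply: ReducedComponent.
Qed.

End Blocks.

(** * Regrouping a factorization by reduced blocks *)

Section Canonical.
Variables (R : realType) (V : finType) (d : V -> measure_display).
Variable X : forall v : V, measurableType (d v).
Variable mu : forall v : V, {sigma_finite_measure set (X v) -> \bar R}.
Variables (A : {set V}) (H : hypergraph V).
Hypothesis dahH : is_DAH H.
Local Notation E := (reduction A H).

Lemma component_productE tau (psi : {set V} -> configuration X -> R) y :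
  tau \in chain_components H ->
  component_product H tau psi y =
  \prod_(h | (h \in nondominated H) && (head_of h \subset tau))
     psi (vertices_of h) y.
Proof.
move=> tauH; rewrite /component_product maximal_supportsE //.
rewrite big_imset /=; last exact: vertices_inj.
by apply: eq_bigl => h; rewrite [LHS]inE.
Qed.

(** Potentials with different labels share no coordinate of [tau :\: A], so [normalized_prod]
    applies. The empty label is normalized over no coordinate and yields a positivity indicator; a
    vertex of [A] is alone in its reduced component, which receives no hyperedge and contributes
    [1]. *)
Lemma conditional_factor_reduction tau (psi : {set V} -> configuration X -> R)
    x :
  tau \in chain_components H ->
  (forall S, S \in maximal_supports (hyperedges_into H tau) ->
     is_potential S (psi S)) ->
  conditional_factor mu A H tau psi x =
  \prod_(sigma | (sigma == finset.set0) ||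
           (sigma \in chain_components E) && (sigma \subset tau))
    normalized mu (sigma :\: A)
      (fun y => \prod_(h | [&& h \in nondominated H, head_of h \subset tau &
                            reduced_block A H h == sigma])
                 psi (vertices_of h) y) x.
Proof.
move=> tauH pot.
have poth h : h \in nondominated H -> head_of h \subset tau ->
    is_potential (vertices_of h) (psi (vertices_of h)).
  move=> hD htau; apply: pot; rewrite maximal_supportsE //.
  by apply: imset_f; apply/finset.setIdP.
rewrite conditional_factorE => [|S /pot[]//].
have -> : component_product H tau psi = fun y =>
    \prod_(sigma | (sigma == finset.set0) ||
           (sigma \in chain_components E) && (sigma \subset tau))
      \prod_(h | [&& h \in nondominated H, head_of h \subset tau &
                            reduced_block A H h == sigma])
                 psi (vertices_of h) y.
  apply: funext => y; rewrite component_productE //.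
  rewrite (partition_big (reduced_block A H)
    (fun sigma => (sigma == finset.set0) ||
       (sigma \in chain_components E) && (sigma \subset tau))) /=.
    by apply: eq_bigr => sigma _; apply: eq_bigl => h; rewrite andbA.
  move=> h /andP[hD htau]; case: (reduced_blockP A hD) => [|v vh vA].
    by rewrite eqxx.
  rewrite component_chain orbC /=.
  have vtau := fintype.subsetP htau v vh.
  by rewrite (mem_chain_component tauH vtau) component_reduction.
have poth' sigma h : [&& h \in nondominated H, head_of h \subset tau &
    reduced_block A H h == sigma] ->
    is_potential (vertices_of h) (psi (vertices_of h)).
  by case/and3P => hD htau _; apply: poth.
have potT sigma : is_potential [set: V] (fun y =>
    \prod_(h | [&& h \in nondominated H, head_of h \subset tau &
                            reduced_block A H h == sigma])
                 psi (vertices_of h) y).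
  apply: potential_prod => h /poth'; apply: potential_widen.
  exact: finset.subsetT.
rewrite (normalized_prod mu (B := fun sigma => sigma :\: A)) //.
- by move=> sigma _; have [] := potT sigma.
- by move=> sigma _; have [] := potT sigma.
- move=> sigma /orP[/eqP->|/andP[_ st]]; last exact: finset.setSD.
  by rewrite finset.set0D finset.sub0set.
move=> v; rewrite inE => /andP[vA vtau]; exists (component E v).
  rewrite component_chain (mem_chain_component tauH vtau).
  by rewrite component_reduction orbT.
split; first by rewrite inE vA component_refl.
move=> sigma sP sv.
have vsigma : v \notin sigma.
  apply: contra sv => vs; case/orP: sP => [/eqP s0|/andP[sE _]].
    by rewrite s0 inE in vs.
  by rewrite (mem_chain_component sE vs).
split=> [|y z]; first by rewrite inE negb_and vsigma orbT.
apply: eq_bigr => h hP; have [_ _ hdep] := poth' _ _ hP.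
(* The vertex [v] is off the support of [h]: it lies in [tau], hence not in the tail, and a head
   vertex outside [A] would lie in the block [sigma] of [h]. *)
apply: (depends_only_on_dfwith hdep); case/and3P: hP => hD htau /eqP hs.
have [hH h0 _] := nondominatedP _ _ hD.
rewrite /vertices_of inE negb_or; apply/andP; split.
  apply/negP => /(tail_notin_component dahH tauH hH htau h0).
  by rewrite vtau.
apply: contra vsigma => vh; rewrite -hs;
  apply: (fintype.subsetP (block_sub _ (reduce A h))).
exact/finset.setDP.
Qed.

Lemma nondominated_component h :
  h \in nondominated H ->
  exists2 v, v \in head_of h & block H (head_of h) = component H v.
Proof.
move=> /nondominatedP[hH /set0Pn[v vh] _]; exists v => //.
exact: block_head.
Qed.

(** Membership in [tau] becomes a value of the function [block H], the form that [partition_big]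
    requires. *)
Lemma block_chain_component tau h :
  tau \in chain_components H -> h \in nondominated H ->
  (head_of h \subset tau) = (block H (head_of h) == tau).
Proof.
move=> tauH hD; have [v vh hv] := nondominated_component hD.
apply/idP/eqP => [htau|<-]; last exact: block_sub.
by rewrite hv -(mem_chain_component tauH) // (fintype.subsetP htau).
Qed.

Variable psi : {set V} -> {set V} -> configuration X -> R.
Hypothesis pot : forall tau S, tau \in chain_components H ->
  S \in maximal_supports (hyperedges_into H tau) -> is_potential S (psi tau S).

Definition edge_potential h := psi (block H (head_of h)) (vertices_of h).

Lemma edge_potentialP h :
  h \in nondominated H -> is_potential (vertices_of h) (edge_potential h).
Proof.
move=> hD; have [v vh hv] := nondominated_component hD.
rewrite /edge_potential hv; apply: pot; first exact: component_chain.
rewrite maximal_supportsE ?component_chain //; apply: imset_f.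
by apply/finset.setIdP; rewrite -hv block_sub.
Qed.

(** Every reduced component lies in exactly one chain component of [H], so the products over [tau]
    and over the components inside [tau] merge into one. *)
Lemma prod_conditional_factor x :
  \prod_(tau in chain_components H) conditional_factor mu A H tau (psi tau) x =
  \prod_(sigma in finset.set0 |: chain_components E)
    normalized mu (sigma :\: A)
      (fun y => \prod_(h | (h \in nondominated H) &&
                           (reduced_block A H h == sigma))
                 edge_potential h y) x.
Proof.
have n0 K : (finset.set0 : {set V}) \notin chain_components K.
  by apply/negP => /chain_component_neq0[v]; rewrite inE.
rewrite big_setU1 //=.
have potT h : h \in nondominated H -> is_potential [set: V] (edge_potential h).
  by move=> /edge_potentialP; apply: potential_widen; apply: finset.subsetT.
(* Each reduced component [sigma] is assigned to its chain component [block H sigma]; the empty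
   label belongs to none and is treated once in every [tau]. *)
transitivity (\prod_(tau in chain_components H)
  (normalized mu finset.set0 (fun y => \prod_(h | [&& h \in nondominated H,
      reduced_block A H h == finset.set0 & block H (head_of h) == tau])
                 edge_potential h y) x *
   \prod_(sigma | (sigma \in chain_components E) && (block H sigma == tau))
    normalized mu (sigma :\: A)
      (fun y => \prod_(h | (h \in nondominated H) &&
                           (reduced_block A H h == sigma))
                 edge_potential h y) x)).
  apply: eq_bigr => tau tauH.
  rewrite conditional_factor_reduction //; last first.
    by move=> S; apply: pot.
  rewrite (bigD1 finset.set0) /=; last by rewrite eqxx.
  rewrite finset.set0D; congr (_ * _).
    apply: eq_normalized => y _; apply: eq_big => [h|h /and3P[hD htau _]].
      have [hD /=|] // := boolP (h \in nondominated H).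
      by rewrite (block_chain_component tauH hD) andbC.
    by move: htau; rewrite (block_chain_component tauH hD) => /eqP <-.
  apply: eq_big => [sigma|sigma].
    have [->|s0] /= := eqVneq sigma finset.set0.
      by rewrite (negbTE (n0 _)).
    rewrite andbT; have [sE /=|] // := boolP (sigma \in chain_components E).
    have [v vs] := chain_component_neq0 sE.
    rewrite (block_reduction sE vs); have sv := mem_chain_component sE vs.
    apply/idP/eqP => [st|<-]; last by rewrite sv component_reduction.
    by rewrite -(mem_chain_component tauH) // (fintype.subsetP st).
  case/andP => /orP[/eqP->|/andP[sE st] _]; first by rewrite eqxx.
  apply: eq_normalized => y _; apply: eq_big => [h|h /and3P[hD htau _]].
    have [hD /=|] // := boolP (h \in nondominated H).
    rewrite andb_idl // => /eqP hs.
    have [hH _ _] := nondominatedP _ _ hD.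
    move: hs; case: (reduced_blockP A hD) => [_ s0|v vh vA sv].
      by move: sE; rewrite -s0 (negbTE (n0 _)).
    apply: (head_sub_chain_component tauH hH vh); apply: (fintype.subsetP st).
    by rewrite -sv component_refl.
  by move: htau; rewrite (block_chain_component tauH hD) => /eqP <-.
rewrite big_split /=; congr (_ * _).
  (* The positivity indicators of the various [tau] multiply to a single one: this is
     [normalized_prod] with nothing to integrate, where the covering condition is vacuous. *)
  rewrite finset.set0D -(normalized_prod mu (B := fun _ => finset.set0)
    (C := finset.set0)) //; first last.
  - by move=> v; rewrite inE.
  - move=> tau _; have [] // := @potential_prod _ _ _ X _ (fun h =>
      [&& h \in nondominated H, reduced_block A H h == finset.set0 &
          block H (head_of h) == tau]) [set: V] edge_potential.
    by move=> h /and3P[/potT].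
  - by move=> tau _ y; apply: prodr_ge0 => h /and3P[/potT[]].
  apply: eq_normalized => y _; rewrite [RHS](partition_big
    (fun h => block H (head_of h)) (mem (chain_components H))) /=.
    by apply: eq_bigr => tau _; apply: eq_bigl => h; rewrite andbA.
  move=> h /andP[hD _]; have [v _ ->] := nondominated_component hD.
  exact: component_chain.
rewrite [RHS](partition_big (block H) (mem (chain_components H))) //=.
move=> sigma sE; have [v vs] := chain_component_neq0 sE.
by rewrite (block_reduction sE vs); apply: component_chain.
Qed.

End Canonical.

(** * Transport of potentials between equivalent hypergraphs *)

Section Transfer.
Variables (R : realType) (V : finType) (d : V -> measure_display).
Variable X : forall v : V, measurableType (d v).
Variable mu : forall v : V, {sigma_finite_measure set (X v) -> \bar R}.
Variables (A : {set V}) (a0 : configuration X) (H1 H2 : hypergraph V).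
Hypotheses (dah1 : is_DAH H1) (dah2 : is_DAH H2).
Hypothesis equiv : factorization_equivalent A H1 H2.

Section Potentials.
Variable psi : {set V} -> {set V} -> configuration X -> R.
Hypothesis pot : forall tau S, tau \in chain_components H1 ->
  S \in maximal_supports (hyperedges_into H1 tau) -> is_potential S (psi tau S).

Definition reduced_potential (e : hyperedge V) (x : configuration X) : R :=
  \prod_(h | (h \in nondominated H1) && (reduce A h == e))
     edge_potential H1 psi h (intervene A a0 x).

(* Several hyperedges of [H2] may have the same reduction; one of them carries
   the whole potential, the others carry [1]. *)
Definition representative (e : hyperedge V) : option (hyperedge V) :=
  [pick h in nondominated H2 | reduce A h == e].

(** Potentials are indexed by supports, so the hyperedge is first recovered by splitting [S] along
    [tau], as in [vertices_split]. *)
Definition transferred_potential tau (S : {set V}) : configuration X -> R :=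
  let h : hyperedge V := (S :\: tau, S :&: tau) in
  if representative (reduce A h) == Some h then reduced_potential (reduce A h)
  else fun=> 1.

(** The hyperedges of [H1] collected here have the same support as [h] off [A], and [intervene]
    removes the dependence on [A]. *)
Lemma reduced_potentialP h :
  is_potential (vertices_of h) (reduced_potential (reduce A h)).
Proof.
apply: potential_prod => h1 /andP[h1D /eqP h1h].
have ph1 := edge_potentialP dah1 pot h1D.
apply: (potential_widen _ (potential_intervene A a0 ph1)).
have vD h' : vertices_of h' :\: A = vertices_of (reduce A h').
  exact: finset.setDUl.
by rewrite vD h1h -vD finset.subsetDl.
Qed.

Lemma transferred_potentialP tau S :
  tau \in chain_components H2 ->
  S \in maximal_supports (hyperedges_into H2 tau) ->
  is_potential S (transferred_potential tau S).
Proof.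
move=> tau2 _; rewrite /transferred_potential.
case: ifP => _; last exact: potential_one.
by have := reduced_potentialP (S :\: tau, S :&: tau);
  rewrite /vertices_of /= finset.setUC finset.setID.
Qed.

Lemma edge_transferred_potential h :
  h \in nondominated H2 ->
  edge_potential H2 transferred_potential h =
  if representative (reduce A h) == Some h then reduced_potential (reduce A h)
  else fun=> 1.
Proof.
move=> hD; rewrite /edge_potential /transferred_potential.
have [hH h0 _] := nondominatedP _ _ hD.
have [v _ hv] := nondominated_component hD.
have tauH : block H2 (head_of h) \in chain_components H2.
  by rewrite hv component_chain.
have [-> ->] := vertices_split dah2 tauH hH h0 (block_sub H2 h).
by case: h {hD hH h0 v hv tauH}.
Qed.

Lemma prod_transferred_potential e y :
  e \in reduction A H2 -> intervened_at A a0 y ->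
  \prod_(h | (h \in nondominated H2) && (reduce A h == e))
     edge_potential H2 transferred_potential h y =
  \prod_(h | (h \in nondominated H1) && (reduce A h == e))
     edge_potential H1 psi h y.
Proof.
move=> eE yA; case rE : (representative e) => [r|]; last first.
  (* Since [e] is a reduction of some hyperedge of [H2], a representative exists. *)
  move: eE rE => /imsetP[h hD eh]; rewrite /representative.
  by case: pickP => // /(_ h); rewrite hD eh eqxx.
have /andP[rD /eqP re] : (r \in nondominated H2) && (reduce A r == e).
  by move: rE; rewrite /representative; case: pickP => // h hP [<-].
rewrite (bigD1 r) ?rD ?re ?eqxx //= big1 => [|h /andP[/andP[hD /eqP he] hr]].
  rewrite edge_transferred_potential // re rE eqxx mulr1 /reduced_potential.
  by rewrite intervene_id.
rewrite edge_transferred_potential // he rE ifN //.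
by apply: contraNneq hr => -[->].
Qed.

(** The label of a hyperedge depends only on its reduction and on the common reduced hypergraph, so
    both products can be compared one reduction [e] at a time. *)
Lemma block_prod_transferred sigma y :
  intervened_at A a0 y ->
  \prod_(h | (h \in nondominated H2) && (reduced_block A H2 h == sigma))
     edge_potential H2 transferred_potential h y =
  \prod_(h | (h \in nondominated H1) && (reduced_block A H1 h == sigma))
     edge_potential H1 psi h y.
Proof.
move=> yA; pose Q e := (e \in reduction A H2) &&
  (block (reduction A H2) (head_of e) == sigma).
rewrite (partition_big (reduce A) Q) => [|h /andP[hD hs]]; last first.
  by rewrite /Q mem_reduce.
rewrite [RHS](partition_big (reduce A) Q) => [|h /andP[hD hs]]; last first.
  by rewrite /Q -equiv mem_reduce.
apply: eq_bigr => e /andP[eE es].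
transitivity (\prod_(h | (h \in nondominated H2) && (reduce A h == e))
     edge_potential H2 transferred_potential h y).
  apply: eq_bigl => h; rewrite -andbA; congr (_ && _).
  by rewrite andb_idl // => /eqP he; rewrite /reduced_block he.
rewrite prod_transferred_potential //; apply: eq_bigl => h.
rewrite -andbA; congr (_ && _).
by rewrite andb_idl // => /eqP he; rewrite /reduced_block he equiv.
Qed.

End Potentials.

Lemma factorizes_transfer f :
  factorizes mu A a0 H1 f -> factorizes mu A a0 H2 f.
Proof.
move=> [psi [pot fE]]; exists (transferred_potential psi).
split=> [tau S|x xA]; first exact: transferred_potentialP.
rewrite fE // (prod_conditional_factor mu A dah1 pot).
rewrite (prod_conditional_factor mu A dah2 (transferred_potentialP pot)) equiv.
(* Normalizing over [sigma :\: A] keeps the coordinates in [A] at those of [x], so every [y] met is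
   intervened. *)
apply: eq_bigr => sigma _; apply: eq_normalized => y yx.
rewrite block_prod_transferred // => a aA.
by rewrite yx ?xA // inE aA.
Qed.

End Transfer.

Theorem theorem7 (R : realType) (V : finType) (d : V -> measure_display)
    (X : forall v : V, measurableType (d v))
    (mu : forall v : V, {sigma_finite_measure set (X v) -> \bar R})
    (A : {set V}) (a0 : configuration X) (H1 H2 : hypergraph V) :
  is_DAH H1 -> is_DAH H2 ->
  factorization_equivalent A H1 H2 ->
  same_factorization_decomposition mu A a0 H1 H2.
Proof.
by move=> dah1 dah2 equiv f _; split; apply: factorizes_transfer.
Qed.
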